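(* Let $R$ be a (von Neumann) regular ring with a fixed inner inverse operation $'$, i.e. a map $'\colon R\to R$ with $aa'a=a$ for all $a\in R$. Then $R$ is separative if and only if for every idempotent $e\in R$ and all $a,b,c\in eRe$, the element $$x:=(1-aa')\,b\,a\,c\,(1-a'a)+(1-e)$$ is unit-regular in $R$.
   Context: Rings are associative and unital. An element $a\in R$ is (von Neumann) regular if $aba=a$ for some $b\in R$ (such $b$ is an inner inverse of $a$); $R$ is a regular ring if all its elements are regular. An element $a\in R$ is unit-regular in $R$ if $aua=a$ for some unit $u$ of $R$. $\mathrm{FP}(R)$ denotes the category of finitely generated projective right $R$-modules. A ring $R$ is separative if for all $A,B\in \mathrm{FP}(R)$, $A\oplus A\cong A\oplus B\cong B\oplus B$ implies $A\cong B$; for exchange rings (in particular for regular rings) this is equivalent to: for all $A,B,C\in\mathrm{FP}(R)$, $A\oplus C\oplus C\cong B\oplus C\oplus C$ implies $A\oplus C\cong B\oplus C$. Here $a'$ is the value of the fixed operation on $R$ (so $a'$ need not lie in $eRe$). *)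

(* Defs.v *)
From HB Require Import structures.
From mathcomp Require Import all_boot all_algebra.

Set Implicit Arguments.
Unset Strict Implicit.
Unset Printing Implicit Defensive.

Import GRing.Theory.
Local Open Scope ring_scope.

(* Rings are [pzRingType]: associative and unital, with the
   zero ring allowed.  Two-sided invertibility is spelled out, since
   [GRing.unit] would require a nontrivial ring with decidable units. *)
Definition invertible (R : pzRingType) (u : R) : Prop :=
  exists v : R, u * v = 1 /\ v * u = 1.

Definition regular_elt (R : pzRingType) (a : R) : Prop :=
  exists b : R, a * b * a = a.

Definition regular_ring (R : pzRingType) : Prop :=
  forall a : R, regular_elt a.

Definition unit_regular (R : pzRingType) (a : R) : Prop :=
  exists u : R, invertible u /\ a * u * a = a.

Definition idempotent_elt (R : pzRingType) (e : R) : Prop := e * e = e.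

Definition in_corner (R : pzRingType) (e a : R) : Prop :=
  exists r : R, a = e * r * e.

(* Right R-modules are left modules over the converse ring [R^c]: the right
   action of [a] on [v] is [a *: v], and [b *: (a *: v)] is the action on [v]
   of the product of [a] and [b], in this order, in [R]. *)
Definition rmodType (R : pzRingType) := lmodType R^c.

Definition mod_iso (R : pzRingType) (M N : lmodType R) : Prop :=
  exists f : {linear M -> N}, bijective f.

Definition fin_gen (R : pzRingType) (M : lmodType R) : Prop :=
  exists (n : nat) (g : 'I_n -> M),
    forall x : M, exists c : 'I_n -> R, x = \sum_(i < n) c i *: g i.

Definition projective (R : pzRingType) (P : lmodType R) : Prop :=
  forall (M N : lmodType R) (p : {linear M -> N}) (f : {linear P -> N}),
    (forall y : N, exists x : M, p x = y) ->
    exists g : {linear P -> M}, forall x : P, p (g x) = f x.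

Definition in_FP (R : pzRingType) (M : rmodType R) : Prop :=
  fin_gen M /\ projective M.

Definition separative (R : pzRingType) : Prop :=
  forall A B : rmodType R, in_FP A -> in_FP B ->
    mod_iso (A * A)%type (A * B)%type ->
    mod_iso (A * B)%type (B * B)%type ->
    mod_iso A B.

(* Main.v *)
Require Import Defs.
From Stdlib Require Import Setoid Morphisms.
From HB Require Import structures.
From mathcomp Require Import all_boot all_algebra.

Set Implicit Arguments.
Unset Strict Implicit.
Unset Printing Implicit Defensive.

Import GRing.Theory.
Local Open Scope ring_scope.

(** Isomorphism classes of finitely generated projective modules form a
    commutative monoid under direct sum, and both sides of the equivalence are
    cancellation properties of it. Right multiplication by an element [y] is an
    endomorphism of the left module [S e] for [y] in the corner [e S e], and
    [y + (1 - e)] is unit-regular exactly when the kernel and the cokernel of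
    [y] are isomorphic ([corner_unit_regular]). The elements
    [(1 - a a') b a c (1 - a' a)] are the maps from the kernel of [a] to its
    cokernel that factor through the image of [a]. If [g] is the class of the
    image of such a map, the classes of the image, the kernel and the cokernel
    of [a] are [g + r], [g + k] and [g + l], and both ways of adding up to [e]
    give
      [2g + (r + k) = 2g + (r + l)],
    while the kernel and the cokernel of the map are [g + (r + k)] and
    [g + (r + l)]. So the condition on corners is the implication
      [2c + a = 2c + b -> c + a = c + b]
    restricted to sums [2c + a] that are summands of the free module of rank
    one.

    Separativity gives this implication for all classes ([double_cancel]), hence
    unit-regularity ([mx_separative_unit_regular]). Conversely, the corner
    condition gives the restricted implication
    ([small_cancel_of_unit_regular]), and the restriction on the size is
    removed by refinement ([separative_of_small]): over a regular ring
    isomorphic direct sums have isomorphic common refinements ([iadd_refine]).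
    This allows to replace a problem [a + c = b + c], with [c] below [a] and
    [b], by one whose total sum is [c] ([refine_absorbed]), and to cancel a
    general [c] in pieces that are summands of the ring.

    The monoid is realized by idempotent matrices up to Murray-von Neumann
    equivalence, over the converse ring [R^c] since right modules are wanted;
    the last part identifies it with the one of modules. *)

(** * Cancellation in refinement monoids *)

Section RefinementMonoid.
Context (V : Type) (eqv : V -> V -> Prop) (add : V -> V -> V).
Context {eqvE : Equivalence eqv} {addE : Proper (eqv ==> eqv ==> eqv) add}.
Local Infix "==~" := eqv (at level 70).
Local Infix "+~" := add (at level 50, left associativity).
Context (vaddC : forall a b, a +~ b ==~ b +~ a).
Context (vaddA : forall a b c, a +~ (b +~ c) ==~ (a +~ b) +~ c).

Definition below (a b : V) : Prop := exists d, b ==~ a +~ d.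

Lemma vaddAC a b c : (a +~ b) +~ c ==~ (a +~ c) +~ b.
Proof. by rewrite -vaddA (vaddC b c) vaddA; reflexivity. Qed.

Lemma vaddACA a b c d : (a +~ b) +~ (c +~ d) ==~ (a +~ c) +~ (b +~ d).
Proof. by rewrite !vaddA (vaddAC a b c); reflexivity. Qed.

#[local] Instance below_proper : Proper (eqv ==> eqv ==> iff) below.
Proof.
move=> a a' aE b b' bE.
by split=> -[d dE]; exists d; [rewrite -bE -aE|rewrite bE aE].
Qed.

Lemma below_addl a b : below a (a +~ b).
Proof. by exists b; reflexivity. Qed.

Lemma below_addr a b : below b (a +~ b).
Proof. by rewrite vaddC; apply: below_addl. Qed.

Lemma below_trans a b c : below a b -> below b c -> below a c.
Proof.
by case=> d bE [d' ->]; exists (d +~ d'); rewrite bE vaddA; reflexivity.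
Qed.

(** Both [c + a] and [c + b], doubled or added together, give
    [2c + a + b] up to the hypothesis, so separativity applies to them. *)
Lemma double_cancel c a b :
    (forall a b, a +~ a ==~ a +~ b -> a +~ b ==~ b +~ b -> a ==~ b) ->
  (c +~ c) +~ a ==~ (c +~ c) +~ b -> c +~ a ==~ c +~ b.
Proof.
move=> sep E; apply: sep; rewrite !(vaddACA c _ c).
  by rewrite (vaddC a b) !vaddA E; reflexivity.
by rewrite !vaddA E; reflexivity.
Qed.

Context (refine : forall a b c d, a +~ b ==~ c +~ d ->
  exists x y z w, [/\ a ==~ x +~ y, b ==~ z +~ w, c ==~ x +~ z & d ==~ y +~ w]).

Lemma below_split c a b : below c (a +~ b) ->
  exists c1 c2, [/\ c ==~ c1 +~ c2, below c1 a & below c2 b].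
Proof.
case=> d /refine[x [y [z [w [aE bE cE dE]]]]]; exists x, z.
by split; rewrite ?aE ?bE //; apply: below_addl.
Qed.

(** The 2 by 2 refinement of [a + c == b + c] with rows [d a1] and [b1 c1],
    row sums [a] and [c], column sums [b] and [c]. *)
Definition refinement_matrix a b c d a1 b1 c1 :=
  [/\ a ==~ d +~ a1, b ==~ d +~ b1, c ==~ a1 +~ c1 & c ==~ b1 +~ c1].

(** Since [c1] lies below [a == d + a1], it splits into [x] below [d] and [y]
    below [a1]; moving [x] from both diagonal entries to both off-diagonal
    ones keeps the row and column sums. *)
Lemma refinement_matrix_shrink a b c d a1 b1 c1 :
    refinement_matrix a b c d a1 b1 c1 -> below c a ->
  exists d' x y, [/\ refinement_matrix a b c d' (a1 +~ x) (b1 +~ x) y,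
                     below y c1 & below y a1].
Proof.
move=> [aE bE cE cE' ca].
have : below c1 (d +~ a1).
  by rewrite -aE; apply: below_trans ca; rewrite cE; apply: below_addr.
move=> /below_split[x [y [c1E [d' dE] ya]]]; exists d', x, y; split=> //.
- split.
  + by rewrite aE dE (vaddC x) -vaddA (vaddC x); reflexivity.
  + by rewrite bE dE (vaddC x) -vaddA (vaddC x); reflexivity.
  + by rewrite cE c1E vaddA; reflexivity.
  + by rewrite cE' c1E vaddA; reflexivity.
- by rewrite c1E; apply: below_addr.
Qed.

(** Shrinking the corner entry [c1] first against [a], then against [b]. The
    point is that [a1 + c1 == b1 + c1 == c] is again a cancellation problem,
    whose sum is now only [c], no matter how large [a] and [b] are. *)
Lemma refine_absorbed a b c : a +~ c ==~ b +~ c -> below c a -> below c b ->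
  exists d a1 b1 c1, [/\ refinement_matrix a b c d a1 b1 c1,
                         below c1 a1 & below c1 b1].
Proof.
move=> /refine[d [a1 [b1 [c1 [aE cE bE cE']]]]] ca cb.
have rm : refinement_matrix a b c d a1 b1 c1.
  by split=> //; rewrite ?cE'.
have [d' [x [y [[aE1 bE1 cE1 cE1'] yc ya]]]] := refinement_matrix_shrink rm ca.
have rm' : refinement_matrix b a c d' (b1 +~ x) (a1 +~ x) y by split.
have [d2 [x' [y' [[bE2 aE2 cE2 cE2'] y'y y'b]]]] :=
  refinement_matrix_shrink rm' cb.
exists d2, ((a1 +~ x) +~ x'), ((b1 +~ x) +~ x'), y'; split=> //.
  apply: below_trans y'y _; apply: below_trans ya _.
  by rewrite -vaddA; apply: below_addl.
by apply: below_trans y'b _; apply: below_addl.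
Qed.

(** From here on, doubled terms may be cancelled only when the whole sum lies
    below a fixed element [r], and the elements below [r] generate [V]. *)
Context (r : V) (small_cancel : forall c a b, below ((c +~ c) +~ a) r ->
  (c +~ c) +~ a ==~ (c +~ c) +~ b -> c +~ a ==~ c +~ b).

Definition cancellable c := forall a b,
  below c a -> below c b -> a +~ c ==~ b +~ c -> a ==~ b.

(** By [refine_absorbed] it suffices to cancel [c1] in [a1 + c1 == b1 + c1];
    writing [a1 == c1 + a2] and [b1 == c1 + b2] gives the doubled form
    [2 c1 + a2 == 2 c1 + b2], with sum [c] below [r]. *)
Lemma small_cancellable c : below c r -> cancellable c.
Proof.
move=> sc a b ca cb E.
have [d [a1 [b1 [c1 [[aE bE cE cE'] [a2 a1E] [b2 b1E]]]]]] :=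
  refine_absorbed E ca cb.
have cE2 : c ==~ (c1 +~ c1) +~ a2.
  by rewrite cE a1E vaddAC; reflexivity.
rewrite aE bE a1E b1E; apply: addE; first reflexivity.
apply: small_cancel; rewrite -cE2 //.
by rewrite cE' b1E vaddAC; reflexivity.
Qed.

Lemma cancellable_add c d :
  cancellable c -> cancellable d -> cancellable (c +~ d).
Proof.
move=> cc cd a b cda cdb E.
have below_l u : below (c +~ d) u -> below c u.
  by apply: below_trans; apply: below_addl.
have below_r u : below (c +~ d) u -> below d (u +~ c).
  move=> cdu; apply: below_trans (below_addl _ _).
  by apply: below_trans cdu; apply: below_addr.
apply: cc; [exact: below_l|exact: below_l|].
by apply: cd; [exact: below_r|exact: below_r|rewrite -!vaddA].
Qed.

Context (small_gen : forall P : V -> Prop, (forall a, below a r -> P a) ->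
  (forall a b c, P a -> P b -> c ==~ a +~ b -> P c) -> forall a, P a).

Lemma all_cancellable c : cancellable c.
Proof.
apply: small_gen c => [c|a b c Pa Pb cE]; first exact: small_cancellable.
move=> u v; rewrite cE; exact: (cancellable_add Pa Pb).
Qed.

(** [a + a == b + a], and [a] lies below [2b], hence is a sum of two elements
    below both [a] and [b], which can be cancelled one after the other. *)
Lemma separative_of_small a b :
  a +~ a ==~ a +~ b -> a +~ b ==~ b +~ b -> a ==~ b.
Proof.
move=> E1 E2.
have [a1 [a2 [aE a1b a2b]]] : exists a1 a2,
    [/\ a ==~ a1 +~ a2, below a1 b & below a2 b].
  by apply: below_split; rewrite -E2; apply: below_addl.
have a1a : below a1 a by rewrite aE; apply: below_addl.
have a2a : below a2 a by rewrite aE; apply: below_addr.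
apply: (all_cancellable a1a a1b); apply: (@all_cancellable a2).
- by apply: below_trans (below_addl _ _).
- by apply: below_trans (below_addl _ _).
- by rewrite -!vaddA -aE E1 vaddC; reflexivity.
Qed.

End RefinementMonoid.

(** * Idempotents and unit-regular elements of a ring *)

Section Rings.
Context (T : pzRingType).
Implicit Types a b c d e f p q x y : T.

Lemma mulAE u v w : u * v = w -> forall x : T, x * u * v = x * w.
Proof. by move=> <- x; rewrite mulrA. Qed.

Lemma mulA3E u v w t : u * v * w = t -> forall x : T, x * u * v * w = x * t.
Proof. by move=> <- x; rewrite !mulrA. Qed.

(** Murray-von Neumann equivalence. On idempotents it says that the left
    modules [T e] and [T f] are isomorphic, by right multiplication by [x] and
    [y]. *)
Definition mvn e f := exists x y, x * y = e /\ y * x = f.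

Definition orth_dec e e1 e2 :=
  [/\ e1 * e1 = e1, e2 * e2 = e2, e1 * e2 = 0, e2 * e1 = 0 & e = e1 + e2].

Lemma orth_dec_sub e f : e * e = e -> f * f = f -> e * f = f -> f * e = f ->
  orth_dec e f (e - f).
Proof.
move=> ee ff ef fe; split=> //; last by rewrite addrC subrK.
- by rewrite mulrBr !mulrBl ee ef fe ff subrr subr0.
- by rewrite mulrBr fe ff subrr.
- by rewrite mulrBl ef ff subrr.
Qed.

Lemma compl_idem p : p * p = p -> (1 - p) * (1 - p) = 1 - p.
Proof. by move=> pp; rewrite mulrBr mulr1 mulrBl mul1r pp subrr subr0. Qed.

Lemma orth_decP e e1 e2 : orth_dec e e1 e2 ->
  [/\ e * e = e, e * e1 = e1, e1 * e = e1, e * e2 = e2 & e2 * e = e2].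
Proof.
by case=> h1 h2 h12 h21 ->; split;
   rewrite ?(mulrDl, mulrDr) ?h1 ?h2 ?h12 ?h21 ?addr0 ?add0r.
Qed.

(** Two complements of [T a] in [T s] are isomorphic: [T b] is one by
    hypothesis, and [pi] is the projection onto [T k] along [T a]. *)
Lemma complement_mvn s a b k pi : orth_dec s a b ->
  k * s = k -> k * k = k ->
  a * pi = 0 -> k * pi = k -> pi * k = pi -> pi * b = b -> mvn b k.
Proof.
move=> sab ks kk api kpi pik pib.
have [ss sa as_ sb bs] := orth_decP sab; have [aa bb _ _ sE] := sab.
exists (b * pi), (k * b); split.
  by rewrite -mulrA (mulrA pi) pik pib bb.
have bE : b = s - a by rewrite sE addrC addKr.
by rewrite mulrA (mulAE bb) bE mulrBr ks mulrBl kpi -mulrA api mulr0 subr0.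
Qed.

(** Refinement in the lattice of direct summands of [T s]. Let [p] be the
    projection of [T a] to [T c] along [T d]. As [p] is regular, its kernel [a2]
    and its image [c1] are direct summands; [a2] lies in [T d], where it has a
    complement [d2], and [c1] has a complement [c2] in [T c]. Then [T s] is the
    direct sum of [T a], [T c2] and [T d2], so that [T b] is isomorphic to the
    sum of the last two. *)
Lemma orth_refine s a b c d : (forall x, exists y, x * y * x = x) ->
  orth_dec s a b -> orth_dec s c d ->
  exists a1 a2 c1 c2 d1 d2 k,
    [/\ orth_dec a a1 a2, orth_dec c c1 c2, orth_dec d d1 d2
      & orth_dec k c2 d2] /\ [/\ mvn a1 c1, mvn a2 d1 & mvn b k].
Proof.
move=> reg sab scd.
have [ss sa as_ sb bs] := orth_decP sab; have [aa bb ab ba sE] := sab.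
have [_ sc cs sd ds] := orth_decP scd; have [cc dd cd dc sE'] := scd.
have [p pE] : exists p, p = a * c by exists (a * c).
have [q0 q0E] := reg p.
have ap : a * p = p by rewrite pE mulrA aa.
have pc : p * c = p by rewrite pE -mulrA cc.
(* A reflexive inner inverse of [p], mapping [T c] to [T a]. *)
have [q qE] : exists q, q = c * q0 * p * q0 * a by eexists.
have cq : c * q = q by rewrite qE !mulrA cc.
have qa : q * a = q by rewrite qE -!mulrA aa.
have pqp : p * q * p = p.
  by rewrite qE !mulrA pc (mulAE ap) !q0E.
have qpq : q * p * q = q.
  by rewrite qE !mulrA (mulAE ap) (mulAE pc) !(mulA3E q0E).
(* [p * q] is the part of [a] mapped isomorphically to [c1] by [p]; the rest
   [a2] is the kernel of [p]. *)
have [c1 c1E] : exists c1, c1 = q * p by eexists.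
have [c2 c2E] : exists c2, c2 = c - c1 by eexists.
have [a2 a2E] : exists a2, a2 = a - p * q by eexists.
have dec_a : orth_dec a (p * q) a2.
  rewrite a2E; apply: orth_dec_sub => //; first by rewrite mulrA pqp.
    by rewrite mulrA ap.
  by rewrite -mulrA qa.
have dec_c : orth_dec c c1 c2.
  rewrite c2E c1E; apply: orth_dec_sub => //; first by rewrite mulrA qpq.
    by rewrite mulrA cq.
  by rewrite -mulrA pc.
have [_ _ _ _ a2a] := orth_decP dec_a; have [_ a2a2 _ _ _] := dec_a.
have a2c : a2 * c = 0.
  by rewrite -a2a -mulrA -pE a2E mulrBl ap pqp subrr.
have a2d : a2 * d = a2.
  by rewrite -[RHS]a2a -[in RHS]as_ !mulrA a2a sE' mulrDr a2c add0r.
have [d1 d1E] : exists d1, d1 = d * a2 by eexists.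
have [d2 d2E] : exists d2, d2 = d - d1 by eexists.
have dec_d : orth_dec d d1 d2.
  rewrite d2E d1E; apply: orth_dec_sub => //.
  - by rewrite mulrA (mulAE a2d) (mulAE a2a2).
  - by rewrite mulrA dd.
  - by rewrite -mulrA a2d.
have [_ cc1 c1c cc2 c2c] := orth_decP dec_c.
have [_ dd1 d1d dd2 d2d] := orth_decP dec_d.
have [_ c2c2 _ _ _] := dec_c; have [_ d2d2 _ _ _] := dec_d.
have c2d2 : c2 * d2 = 0 by rewrite -c2c -dd2 mulrA (mulAE cd) mulr0 mul0r.
have d2c2 : d2 * c2 = 0 by rewrite -d2d -cc2 mulrA (mulAE dc) mulr0 mul0r.
have dec_k : orth_dec (c2 + d2) c2 d2 by [].
exists (p * q), a2, c1, c2, d1, d2, (c2 + d2); split=> //; split.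
- by exists p, q.
- by exists a2, (d * a2); rewrite mulrA a2d a2a2 -mulrA a2a2.
have d2q : d2 * q = 0 by rewrite -d2d -cq mulrA (mulAE dc) mulr0 mul0r.
have c2q : c2 * q = 0 by rewrite c2E c1E mulrBl cq qpq subrr.
have aq : a * q = p * q by rewrite -{1}cq mulrA -pE.
have a2d2 : a2 * d2 = 0.
  by rewrite d2E d1E mulrBr a2d mulrA a2d a2a2 subrr.
have ad2 : a * d2 = p * q * d2.
  by have [_ _ _ _ ->] := dec_a; rewrite mulrDl a2d2 addr0.
have qs : q * s = q by rewrite -qa -mulrA as_.
have a2b : a2 * b = 0 by rewrite -a2a -mulrA ab mulr0.
have d2b : d2 * b = d * b by rewrite d2E d1E mulrBl -mulrA a2b mulr0 subr0.
(* To project [v] to [T c2 + T d2] along [T a], subtract [v q], which lies in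
   [T a]: the [c]-component becomes [v c2] and the [d]-component
   [v (1 - q) d]. The latter is then projected to [d2] along [a2]. *)
apply: (complement_mvn (pi := c2 + (1 - q) * d2) sab).
- by rewrite mulrDl -{1}c2c -{1}d2d -!mulrA cs ds c2c d2d.
- by rewrite mulrDl !mulrDr c2c2 c2d2 d2c2 d2d2 addr0 add0r.
- rewrite mulrDr mulrA mulrBr mulr1 mulrBl aq ad2 subrr addr0.
  by rewrite c2E c1E mulrBr -pE mulrA aq pqp subrr.
- rewrite mulrDl !mulrDr !mulrA !mulrBr !mulr1 c2q d2q !subr0.
  by rewrite c2d2 d2c2 c2c2 d2d2 addr0 add0r.
- by rewrite mulrDl !mulrDr c2c2 c2d2 -!mulrA d2c2 d2d2 mulr0 addr0 add0r.
have qpb : q * p * b = q * (c * b) by rewrite pE !mulrA qa.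
have qsb : q * (c * b) + q * (d * b) = 0.
  by rewrite -mulrDr -mulrDl -sE' sb -qa -mulrA ab mulr0.
rewrite mulrDl -mulrA d2b mulrBl mul1r c2E c1E mulrBl qpb.
by rewrite addrACA -opprD qsb subr0 -mulrDl -sE' sb.
Qed.

(** The maps witnessing an equivalence can be cut down to the modules that they
    relate. *)
Lemma mvn_norm e f : e * e = e -> f * f = f -> mvn e f ->
  exists x y, [/\ x * y = e, y * x = f, e * x = x & x * f = x]
              /\ (f * y = y /\ y * e = y).
Proof.
move=> ee ff [x [y [xy yx]]].
have ye : y * e = f * y by rewrite -xy -yx mulrA.
have xf : x * f = e * x by rewrite -xy -yx mulrA.
exists (e * x), (y * e); split; first split.
- by rewrite -mulrA (mulrA x) xy !mulrA !ee.
- by rewrite mulrA (mulAE ee) ye -mulrA yx ff.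
- by rewrite mulrA ee.
- by rewrite -mulrA xf mulrA ee.
- by split; rewrite ?mulrA -?mulrA ?ee // mulrA -ye -mulrA ee.
Qed.

(** From [e = p + (g + r)], removing [g]. *)
Lemma orth_dec_shift e p P g r :
  orth_dec e p P -> orth_dec P g r -> orth_dec (e - g) p r.
Proof.
move=> dec dec'; have [pp PP pP Pp ->] := dec.
have [_ _ _ Pr rP] := orth_decP dec'; have [_ rr _ _ ->] := dec'.
split=> //; last by rewrite [g + r]addrC addrA addrK.
  by rewrite -Pr mulrA pP mul0r.
by rewrite -rP -mulrA Pp mulr0.
Qed.

Lemma mvn_of_mutual p p' : p * p' = p' -> p' * p = p -> mvn p p'.
Proof. by move=> pp' p'p; exists p', p. Qed.

(** Here [p] and [p'] generate the same right ideal, so [e - p] and [e - p']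
    generate the same left ideal. *)
Lemma mvn_compl e p p' : e * e = e -> e * p = p -> p * e = p ->
  e * p' = p' -> p' * e = p' -> p * p' = p' -> p' * p = p ->
  mvn (e - p) (e - p').
Proof.
move=> ee ep pe ep' p'e pp' p'p; exists (e - p), (e - p').
by split; rewrite mulrBr !mulrBl ?ee ?ep ?pe ?ep' ?p'e ?pp' ?p'p subrr subr0.
Qed.

(** Here [p] and [p'] generate the same left ideal, so that [T (e - p)] and
    [T (e - p')] are complements of the same submodule. *)
Lemma mvn_compl_dual e p p' : e * e = e -> e * p = p -> p * e = p ->
  e * p' = p' -> p' * e = p' -> p * p' = p -> p' * p = p' ->
  mvn (e - p) (e - p').
Proof.
move=> ee ep pe ep' p'e pp' p'p; exists (e - p'), (e - p).
by split; rewrite mulrBl !mulrBr ?ee ?ep ?pe ?ep' ?p'e ?pp' ?p'p subrr subr0.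
Qed.

(** [1 - x z] and [1 - z x] stand for the kernel and the cokernel of right
    multiplication by [x]. An isomorphism [v] from the cokernel to the kernel
    extends [z] to an automorphism [z + v], which is still an inner inverse of
    [x]. *)
Lemma mvn_unit_regular x z : x * z * x = x -> z * x * z = z ->
  mvn (1 - x * z) (1 - z * x) -> unit_regular x.
Proof.
move=> xzx zxz.
have i1 : (1 - x * z) * (1 - x * z) = 1 - x * z.
  by apply: compl_idem; rewrite mulrA xzx.
have i2 : (1 - z * x) * (1 - z * x) = 1 - z * x.
  by apply: compl_idem; rewrite mulrA zxz.
case/(mvn_norm i1 i2) => u [v [[uv vu xu ux] [zv vz]]].
have xv : x * v = 0 by rewrite -zv mulrA mulrBr mulr1 mulrA xzx subrr mul0r.
have vx : v * x = 0 by rewrite -vz -mulrA mulrBl mul1r xzx subrr mulr0.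
have zu : z * u = 0 by rewrite -xu mulrA mulrBr mulr1 mulrA zxz subrr mul0r.
have uz : u * z = 0 by rewrite -ux -mulrA mulrBl mul1r zxz subrr mulr0.
exists (z + v); split; last by rewrite mulrDr xv addr0.
exists (x + u); split.
  by rewrite mulrDl !mulrDr zu vx addr0 add0r vu addrC subrK.
by rewrite mulrDl !mulrDr xv uz addr0 add0r uv addrC subrK.
Qed.

(** A unit inner inverse [u] conjugates [1 - x u] into [1 - u x]. *)
Lemma unit_regular_mvn x : unit_regular x ->
  exists u, x * u * x = x /\ mvn (1 - x * u) (1 - u * x).
Proof.
case=> u [[v [uv vu]] xux]; exists u; split=> //.
exists (v * (1 - u * x)), u; split.
  by rewrite mulrBr mulr1 mulrA vu mul1r mulrBl vu.
by rewrite mulrA uv mul1r.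
Qed.

End Rings.

(** * Idempotent matrices over a regular ring *)

(** Von Neumann's theorem that matrices over a regular ring are regular, in
    rectangular form so that rows and columns can be added one block at a
    time. For a row block [(P1 P2)], an inner inverse of [P1] splits off its
    image; the part of [P2] outside this image, [G *m P2], is then inverted on
    its own. The column step is the mirror image. *)
Lemma regular_mx (S : pzRingType) : regular_ring S ->
  forall m n (A : 'M[S]_(m, n)), exists X : 'M[S]_(n, m), A *m X *m A = A.
Proof.
move=> reg.
have row_step m n1 n2 :
    (forall A : 'M[S]_(m, n1), exists X : 'M[S]_(n1, m), A *m X *m A = A) ->
    (forall A : 'M[S]_(m, n2), exists X : 'M[S]_(n2, m), A *m X *m A = A) ->
  forall A : 'M[S]_(m, n1 + n2),
    exists X : 'M[S]_(n1 + n2, m), A *m X *m A = A.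
  move=> reg1 reg2 A; rewrite -(hsubmxK A).
  move: (lsubmx A) (rsubmx A) => {A} P1 P2.
  have [Q1 Q1E] := reg1 P1.
  pose G := 1%:M - P1 *m Q1.
  have GP1 : G *m P1 = 0 by rewrite mulmxBl mul1mx Q1E subrr.
  have [Q2 Q2E] := reg2 (G *m P2).
  exists (col_mx (Q1 *m (1%:M - P2 *m Q2 *m G)) (Q2 *m G)).
  have -> : row_mx P1 P2 *m col_mx (Q1 *m (1%:M - P2 *m Q2 *m G)) (Q2 *m G)
            = P1 *m Q1 + G *m P2 *m Q2 *m G.
    rewrite mul_row_col mulmxBr mulmx1 mulmxBr !mulmxA /G !mulmxBl !mul1mx.
    by rewrite addrAC addrA.
  rewrite mul_mx_row; congr row_mx; rewrite mulmxDl.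
    by rewrite Q1E -mulmxA GP1 mulmx0 addr0.
  rewrite -[_ *m G *m P2]mulmxA Q2E /G mulmxBl mul1mx.
  by rewrite addrC subrK.
have col_step m1 m2 n :
    (forall A : 'M[S]_(m1, n), exists X : 'M[S]_(n, m1), A *m X *m A = A) ->
    (forall A : 'M[S]_(m2, n), exists X : 'M[S]_(n, m2), A *m X *m A = A) ->
  forall A : 'M[S]_(m1 + m2, n),
    exists X : 'M[S]_(n, m1 + m2), A *m X *m A = A.
  move=> reg1 reg2 A; rewrite -(vsubmxK A).
  move: (usubmx A) (dsubmx A) => {A} P1 P2.
  have [Q1 Q1E] := reg1 P1.
  pose G := 1%:M - Q1 *m P1.
  have P1G : P1 *m G = 0 by rewrite mulmxBr mulmx1 mulmxA Q1E subrr.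
  have [Q2 Q2E] := reg2 (P2 *m G).
  exists (row_mx ((1%:M - G *m Q2 *m P2) *m Q1) (G *m Q2)).
  rewrite -mulmxA.
  have -> : row_mx ((1%:M - G *m Q2 *m P2) *m Q1) (G *m Q2) *m col_mx P1 P2
            = Q1 *m P1 + G *m Q2 *m (P2 *m G).
    rewrite mul_row_col -!mulmxA mulmxBl mul1mx -!mulmxA /G.
    by rewrite !mulmxBr !mulmx1 addrAC addrA.
  rewrite mul_col_mx; congr col_mx; rewrite mulmxDr.
    by rewrite !mulmxA Q1E P1G !mul0mx addr0.
  rewrite !mulmxA in Q2E *; rewrite Q2E /G mulmxBr mulmx1 mulmxA.
  by rewrite addrC subrK.
have reg11 (A : 'M[S]_1) : exists X : 'M[S]_1, A *m X *m A = A.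
  have [y yE] := reg (A 0 0); exists y%:M.
  by rewrite [A]mx11_scalar -!scalar_mxM yE.
have reg1n n (A : 'M[S]_(1, n)) : exists X : 'M[S]_(n, 1), A *m X *m A = A.
  elim: n A => [|n IH] A; first by exists 0; apply/matrixP=> i [].
  exact: (@row_step 1 1 n).
elim=> [|m IH] n A; first by exists 0; apply/matrixP=> [[]].
exact: (@col_step 1 m n).
Qed.

Section Idempotents.
Context (S : pzRingType).

(** Murray-von Neumann equivalence for idempotents of possibly different
    sizes: isomorphism of the row modules of [e] and [f]. *)
Definition miso m n (e : 'M[S]_m) (f : 'M[S]_n) :=
  exists (x : 'M_(m, n)) (y : 'M_(n, m)), x *m y = e /\ y *m x = f.

Lemma miso_norm m n (e : 'M[S]_m) (f : 'M[S]_n) :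
  e *m e = e -> f *m f = f -> miso e f ->
  exists (x : 'M_(m, n)) (y : 'M_(n, m)),
    [/\ x *m y = e, y *m x = f, e *m x = x & x *m f = x]
    /\ (f *m y = y /\ y *m e = y).
Proof.
move=> ee ff [x [y [xy yx]]].
have ye : y *m e = f *m y by rewrite -xy -yx mulmxA.
have xf : x *m f = e *m x by rewrite -xy -yx mulmxA.
exists (e *m x), (y *m e); split; first split.
- by rewrite -mulmxA (mulmxA x) xy !mulmxA !ee.
- by rewrite mulmxA -(mulmxA y) ee ye -mulmxA yx ff.
- by rewrite mulmxA ee.
- by rewrite -mulmxA xf mulmxA ee.
- by split; rewrite ?mulmxA -?mulmxA ?ee // mulmxA -ye -mulmxA ee.
Qed.

(** An idempotent matrix [e] of size [n] stands for the finitely generated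
    projective left module of the rows [v] with [v *m e = v]. *)
Record idem := Idem { idim : nat; imx :> 'M[S]_idim; imxK : imx *m imx = imx }.

Definition ieqv (e f : idem) := miso e f.
Local Infix "==~" := ieqv (at level 70).

#[global] Instance ieqv_equivalence : Equivalence ieqv.
Proof.
split.
- by move=> e; exists e, e; rewrite imxK.
- by move=> e f [x [y [xy yx]]]; exists y, x.
move=> e f g /(miso_norm (imxK e) (imxK f))[x [y [[xy yx ex xf] [fy ye]]]].
case/(miso_norm (imxK f) (imxK g)) => z [w [[zw wz fz zg] [gw wf]]].
exists (x *m z), (w *m y); split.
  by rewrite mulmxA -(mulmxA x) zw xf.
by rewrite mulmxA -(mulmxA w) yx wf.
Qed.

Lemma iadd_subproof (e f : idem) :
  block_mx e 0 0 f *m block_mx e 0 0 f = block_mx e 0 0 f.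
Proof. by rewrite mulmx_block !imxK !mulmx0 !mul0mx !addr0 add0r. Qed.

Definition iadd e f := Idem (iadd_subproof e f).
Local Infix "+~" := iadd (at level 50, left associativity).

(** Biproduct description of a direct sum: block matrices are replaced by two
    injections and two projections. *)
Lemma ieqv_iaddP (g e f : idem) : g ==~ e +~ f <->
  exists (x1 : 'M_(idim g, idim e)) (y1 : 'M_(idim e, idim g))
         (x2 : 'M_(idim g, idim f)) (y2 : 'M_(idim f, idim g)),
    [/\ x1 *m y1 + x2 *m y2 = g :> 'M_ _, y1 *m x1 = e, y2 *m x2 = f,
        y1 *m x2 = 0 & y2 *m x1 = 0] /\ (x1 *m e = x1 /\ x2 *m f = x2).
Proof.
split.
  case/(miso_norm (imxK g) (imxK (e +~ f))).
  move=> x [y [[]]]; rewrite -(hsubmxK x) -(vsubmxK y) /=.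
  move: (lsubmx x) (rsubmx x) (usubmx y) (dsubmx y) => x1 x2 y1 y2.
  rewrite mul_row_col mul_col_row => xy /eq_block_mx[h1 h2 h3 h4] _.
  rewrite mul_row_block !mulmx0 addr0 add0r => /eq_row_mx[xe xf] _.
  by exists x1, y1, x2, y2.
move=> [x1 [y1 [x2 [y2 [[xy h1 h2 h3 h4] _]]]]].
exists (row_mx x1 x2), (col_mx y1 y2).
by rewrite mul_row_col mul_col_row h1 h2 h3 h4.
Qed.

Lemma iaddC e f : e +~ f ==~ f +~ e.
Proof.
have /ieqv_iaddP[x1 [y1 [x2 [y2 [[h h1 h2 h3 h4] [h5 h6]]]]]] :
  e +~ f ==~ e +~ f by reflexivity.
by apply/ieqv_iaddP; exists x2, y2, x1, y1; rewrite addrC.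
Qed.

Lemma iadd_eqvl e e' f : e ==~ e' -> e +~ f ==~ e' +~ f.
Proof.
case/(miso_norm (imxK e) (imxK e')) => u [v [[uv vu eu ue] [e'v ve]]].
have /ieqv_iaddP[x1 [y1 [x2 [y2 [[h h1 h2 h3 h4] [h5 h6]]]]]] :
  e +~ f ==~ e +~ f by reflexivity.
apply/ieqv_iaddP; exists (x1 *m u), (v *m y1), x2, y2.
split; split=> //.
- by rewrite mulmxA -(mulmxA x1) uv h5.
- by rewrite mulmxA -(mulmxA v) h1 ve vu.
- by rewrite -mulmxA h3 mulmx0.
- by rewrite mulmxA h4 mul0mx.
- by rewrite -mulmxA ue.
Qed.

#[global] Instance iadd_proper : Proper (ieqv ==> ieqv ==> ieqv) iadd.
Proof.
move=> e e' ee' f f' ff'.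
transitivity (e' +~ f); first exact: iadd_eqvl.
transitivity (f +~ e'); first exact: iaddC.
transitivity (f' +~ e'); first exact: iadd_eqvl.
exact: iaddC.
Qed.

Lemma iaddA e f g : e +~ (f +~ g) ==~ e +~ f +~ g.
Proof.
have cast m n (eqmn : m = n) (A : 'M[S]_m) :
    A *m A = A -> miso (castmx (eqmn, eqmn) A) A.
  by case: n / eqmn => AA; rewrite castmx_id; exists A, A.
rewrite /ieqv /= -[X in block_mx _ X _ _](@row_mx0 _ _ (idim f) (idim g)).
rewrite -[X in block_mx _ _ X _](@col_mx0 _ (idim f) (idim g)).
rewrite block_mxA row_mx0 col_mx0.
exact: (cast _ _ _ _ (imxK (e +~ f +~ g))).
Qed.

(** Isomorphism with a direct summand. *)
Definition ibelow := below ieqv iadd.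

Lemma orth_dec_iadd (e e1 e2 : idem) (n : nat) (m m1 m2 : 'M[S]_n) :
    orth_dec m m1 m2 -> miso m e -> miso m1 e1 -> miso m2 e2 -> e ==~ e1 +~ e2.
Proof.
move=> dec; have [mm _ _ _ _] := orth_decP dec.
have [m1m1 m2m2 m12 m21 mE] := dec.
move=> ie ie1 ie2.
transitivity (@Idem n m mm); first by case: ie => x [y []]; exists y, x.
transitivity (@Idem n m1 m1m1 +~ @Idem n m2 m2m2); last exact: iadd_proper.
apply/ieqv_iaddP; exists m1, m1, m2, m2; split; split=> //.
by apply: etrans (esym mE); congr (_ + _).
Qed.

Lemma ieqv_split (e a b : idem) : e ==~ a +~ b ->
  exists m1 m2 : 'M[S]_(idim e),
    [/\ orth_dec (imx e) m1 m2, miso m1 a & miso m2 b].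
Proof.
case/ieqv_iaddP=> x1 [y1 [x2 [y2 [[h h1 h2 h3 h4] [h5 h6]]]]].
exists (x1 *m y1), (x2 *m y2); split; last 2 first.
- by exists x1, y1.
- by exists x2, y2.
split=> //.
- by rewrite -[LHS]mulmxA (mulmxA y1) h1 mulmxA h5.
- by rewrite -[LHS]mulmxA (mulmxA y2) h2 mulmxA h6.
- by rewrite -[LHS]mulmxA (mulmxA y1) h3 mul0mx mulmx0.
- by rewrite -[LHS]mulmxA (mulmxA y2) h4 mul0mx mulmx0.
Qed.

(** Both decompositions are transported inside the idempotent [a +~ b], where
    [orth_refine] applies in the ring of square matrices. *)
Lemma iadd_refine a b c d : regular_ring S -> a +~ b ==~ c +~ d ->
  exists x y z w,
    [/\ a ==~ x +~ y, b ==~ z +~ w, c ==~ x +~ z & d ==~ y +~ w].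
Proof.
move=> reg E.
have /ieqv_split[ma [mb [dec ia ib]]] : a +~ b ==~ a +~ b by reflexivity.
have [mc [md [dec' ic id]]] := ieqv_split E.
have [a1 [a2 [c1 [c2 [d1 [d2 [k [[da dc dd dk] [ac ad bk]]]]]]]]] :=
  orth_refine (regular_mx reg (n := _)) dec dec'.
have [c11 c22 _ _ _] := dc; have [d11 d22 _ _ _] := dd.
have [a11 a22 _ _ _] := da; have [kk _ _ _ _] := orth_decP dk.
have [_ bb _ _ _] := dec.
exists (Idem c11), (Idem d11), (Idem c22), (Idem d22).
have mrefl n (m : 'M[S]_n) (mm : m *m m = m) : miso m (Idem mm).
  by exists m, m.
split; first exact: (orth_dec_iadd da).
- have bI : b ==~ @Idem _ mb bb by symmetry.
  transitivity (Idem kk); first by transitivity (@Idem _ mb bb).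
  by apply: (orth_dec_iadd dk); apply: mrefl.
- by apply: (orth_dec_iadd dc) => //; apply: mrefl.
- by apply: (orth_dec_iadd dd) => //; apply: mrefl.
Qed.

Lemma sidem_subproof (e : S) : e * e = e -> (e%:M : 'M_1) *m e%:M = e%:M.
Proof. by move=> ee; rewrite -scalar_mxM ee. Qed.

(** The projective module [S e] generated by an idempotent of [S]. *)
Definition sidem e (ee : e * e = e) := Idem (sidem_subproof ee).
Definition ione := sidem (mulr1 1).

Lemma scalar1_inj : injective (fun x : S => x%:M : 'M_1).
Proof. by move=> x y /matrixP/(_ 0 0); rewrite !mxE. Qed.

Lemma mvn_miso (e f : S) : mvn e f <-> miso (e%:M : 'M_1) (f%:M : 'M_1).
Proof.
split=> -[x [y [xy yx]]].
  by exists x%:M, y%:M; rewrite -!scalar_mxM xy yx.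
exists (x 0 0), (y 0 0); rewrite [x]mx11_scalar [y]mx11_scalar in xy yx.
by rewrite -!scalar_mxM in xy yx; split; apply: scalar1_inj.
Qed.

Lemma orth_dec_scalar (e e1 e2 : S) :
  orth_dec e e1 e2 <-> orth_dec (e%:M : 'M[S]_1) e1%:M e2%:M.
Proof.
have M (x y : S) : (x%:M : 'M_1) * y%:M = (x * y)%:M by rewrite scalar_mxM.
have D (x y : S) : (x%:M : 'M_1) + y%:M = (x + y)%:M by rewrite raddfD.
have Z : 0 = (0%:M : 'M[S]_1) by rewrite raddf0.
split=> -[h1 h2 h3 h4 h5].
  by split; rewrite ?M ?D ?h1 ?h2 ?h3 ?h4 ?h5 // -Z.
by rewrite Z !M D in h1 h2 h3 h4 h5; split; apply: scalar1_inj.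
Qed.

Lemma sidem_split (e : S) (ee : e * e = e) a b : sidem ee ==~ a +~ b ->
  exists (e1 e2 : S) (ee1 : e1 * e1 = e1) (ee2 : e2 * e2 = e2),
    [/\ orth_dec e e1 e2, sidem ee1 ==~ a & sidem ee2 ==~ b].
Proof.
case/ieqv_split=> m1 [m2 []] /=.
rewrite [m1]mx11_scalar [m2]mx11_scalar => /orth_dec_scalar dec i1 i2.
by have [ee1 ee2 _ _ _] := dec; exists (m1 0 0), (m2 0 0), ee1, ee2.
Qed.

Lemma sidem_iadd (e e1 e2 : S) (ee : e * e = e) (ee1 : e1 * e1 = e1)
    (ee2 : e2 * e2 = e2) :
  orth_dec e e1 e2 -> sidem ee ==~ sidem ee1 +~ sidem ee2.
Proof.
move=> /orth_dec_scalar dec; have mrefl (f : S) : f * f = f -> mvn f f.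
  by exists f, f.
by apply: (orth_dec_iadd dec); apply/mvn_miso; apply: mrefl.
Qed.

Lemma sidem_mvn (e f : S) (ee : e * e = e) (ff : f * f = f) :
  sidem ee ==~ sidem ff <-> mvn e f.
Proof. by rewrite mvn_miso. Qed.

(** Every finitely generated projective module is a direct sum of summands of
    [S]: it is a summand of a free module of rank [n], and refinement splits it
    along the coordinates. *)
Lemma idem_generated (P : idem -> Prop) : regular_ring S ->
  (forall a, ibelow a ione -> P a) ->
  (forall a b c, P a -> P b -> c ==~ a +~ b -> P c) -> forall a, P a.
Proof.
move=> reg Psmall Padd.
pose I n := Idem (mulmx1 (1%:M : 'M[S]_n)).
have I_add m n : I (m + n)%N ==~ I m +~ I n.
  by rewrite /ieqv /= -scalar_mx_block; exists 1%:M, 1%:M; rewrite mulmx1.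
have below_I n a : ibelow a (I n) -> P a.
  elim: n a => [|n IH] a aI.
    (* The zero module is a summand of [S]. *)
    apply: Psmall; apply: (below_trans iaddA aI).
    by exists (I 1%N); apply: (I_add 0 1).
  have [a1 [a2 [aE a1I a2I]]] : exists a1 a2,
      [/\ a ==~ a1 +~ a2, ibelow a1 (I 1%N) & ibelow a2 (I n)].
    apply: (below_split (fun a b c d => @iadd_refine a b c d reg)).
    by have [d dE] := aI; exists d; rewrite -dE; symmetry; apply: (I_add 1 n).
  by apply: Padd aE; [apply: Psmall|apply: IH].
move=> a; apply: (below_I (idim a)).
have aa : (a : 'M_(idim a)) * a = a by apply: imxK.
have dec := orth_dec_sub (mulr1 1) aa (mul1r _) (mulr1 _).
have [_ kk _ _ _] := dec; exists (@Idem _ (1 - imx a) kk).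
by apply: (orth_dec_iadd dec); [exists 1%:M, 1%:M; rewrite mulmx1|
  exists a, a; rewrite imxK|exists (1 - imx a), (1 - imx a)].
Qed.

End Idempotents.

(** * The condition on corners *)

Definition mx_separative (S : pzRingType) := forall a b : idem S,
  ieqv (iadd a a) (iadd a b) -> ieqv (iadd a b) (iadd b b) -> ieqv a b.

Section CornerCondition.
Context (S : pzRingType).
Implicit Types e x y z a b c : S.
Local Infix "==~" := (@ieqv S) (at level 70).
Local Infix "+~" := (@iadd S) (at level 50, left associativity).

Lemma in_cornerP e x : e * e = e ->
  in_corner e x <-> e * x = x /\ x * e = x.
Proof.
move=> ee; split=> [[r ->]|[ex xe]]; last by exists x; rewrite ex xe.
by split; rewrite -?mulrA ?ee // !mulrA ee.
Qed.

Lemma corner_shift_mul e y z : e * e = e -> e * y = y -> y * e = y ->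
  e * z = z -> z * e = z -> (y + (1 - e)) * (z + (1 - e)) = y * z + (1 - e).
Proof.
move=> ee ey ye ez ze.
have y1 : y * (1 - e) = 0 by rewrite mulrBr mulr1 ye subrr.
have z1 : (1 - e) * z = 0 by rewrite mulrBl mul1r ez subrr.
by rewrite mulrDl (mulrDr y) (mulrDr (1 - e)) y1 z1 addr0 add0r compl_idem.
Qed.

Lemma corner_shift_inner e y z : e * e = e -> e * y = y -> y * e = y ->
  e * z = z -> z * e = z -> y * z * y = y ->
  (y + (1 - e)) * (z + (1 - e)) * (y + (1 - e)) = y + (1 - e).
Proof.
move=> ee ey ye ez ze yzy.
by rewrite !corner_shift_mul ?yzy // ?mulrA ?ey // -mulrA ze.
Qed.

(** Adding [1 - e] changes neither the kernel nor the cokernel of [y] seen as an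
    endomorphism of [S e], which are [e - y z] and [e - z y]; so unit-regularity
    of the sum means that these are isomorphic. *)
Lemma corner_unit_regular e y z : e * e = e -> e * y = y -> y * e = y ->
  e * z = z -> z * e = z -> y * z * y = y -> z * y * z = z ->
  (unit_regular (y + (1 - e)) <-> mvn (e - y * z) (e - z * y)).
Proof.
move=> ee ey ye ez ze yzy zyz.
have compl u v : e * u = u -> u * e = u -> e * v = v -> v * e = v ->
    1 - (u + (1 - e)) * (v + (1 - e)) = e - u * v.
  move=> *; rewrite corner_shift_mul // opprD opprB addrCA.
  by rewrite [1 + _]addrC subrK addrC.
have inner := corner_shift_inner ee ey ye ez ze yzy.
have inner' := corner_shift_inner ee ez ze ey ye zyz.
split=> [/unit_regular_mvn[u [xux m]]|m]; last first.
  by apply: (mvn_unit_regular inner inner'); rewrite !compl.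
rewrite -!compl //.
move: inner inner' xux m.
move: (y + (1 - e)) (z + (1 - e)) => x w xwx wxw xux m.
have inv_idem (p q : S) : p * q * p = p ->
    (1 - p * q) * (1 - p * q) = 1 - p * q
    /\ (1 - q * p) * (1 - q * p) = 1 - q * p.
  by move=> pqp; split; apply: compl_idem; rewrite mulrA ?pqp // (mulA3E pqp).
have [[i1 i2] [i3 i4]] := (inv_idem _ _ xwx, inv_idem _ _ xux).
(* The complements of the image and of the kernel of [x] given by the inner
   inverses [w] and [u] are isomorphic. *)
apply/(sidem_mvn i1 i2); transitivity (sidem i3).
  apply/sidem_mvn; apply: mvn_compl; rewrite ?mul1r ?mulr1 //.
    by rewrite mulrA xwx.
  by rewrite mulrA xux.
transitivity (sidem i4); first by apply/sidem_mvn.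
apply/sidem_mvn; apply: mvn_compl_dual; rewrite ?mul1r ?mulr1 //.
  by rewrite -mulrA (mulrA x) xwx.
by rewrite -mulrA (mulrA x) xux.
Qed.

(** The inner inverse [a'] need not lie in the corner, but [e a' e] does and is
    again an inner inverse of [a]. It yields idempotents of the corner for the
    coimage and the image of [a] on [S e], and complements of them that are the
    outer factors of the corner condition, multiplied by [e]. *)
Lemma corner_inner_inverse e a a' : e * e = e -> e * a = a -> a * e = a ->
    a * a' * a = a ->
  [/\ orth_dec e (a * a' * e) ((1 - a * a') * e),
      orth_dec e (e * a' * a) (e * (1 - a' * a))
    & mvn (a * a' * e) (e * a' * a)].
Proof.
move=> ee ea ae aa'a; split.
- rewrite mulrBl mul1r; apply: orth_dec_sub; rewrite // ?mulrA.
  + by rewrite (mulAE ea) aa'a.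
  + by rewrite ea.
  + by rewrite (mulAE ee).
- rewrite mulrBr mulr1 mulrA; apply: orth_dec_sub; rewrite // ?mulrA.
  + by rewrite (mulAE ae) (mulA3E aa'a).
  + by rewrite ee.
  + by rewrite (mulAE ae).
exists a, (e * a' * e); rewrite !mulrA ae; split=> //.
by rewrite (mulAE ea).
Qed.

(** The element [y] maps the kernel [P] of [a] to its cokernel [Q], factoring
    through the image of [a]. Its image [g] is therefore also a summand of that
    image, which is [g + r] up to isomorphism. With [P = g + rg] and
    [Q = h + rh], [h] isomorphic to [g], the two decompositions of [e] read
    [2g + r + rg == 2g + r + rh]; separativity cancels one [g], and what is left
    is that the kernel and the cokernel of [y] are isomorphic. *)
Lemma mx_separative_unit_regular e a a' b c :
    regular_ring S -> mx_separative S -> e * e = e ->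
    in_corner e a -> in_corner e b -> in_corner e c -> a * a' * a = a ->
  unit_regular ((1 - a * a') * b * a * c * (1 - a' * a) + (1 - e)).
Proof.
move=> reg sep ee /(in_cornerP _ ee)[ea ae] /(in_cornerP _ ee)[eb be].
move=> /(in_cornerP _ ee)[ec ce] aa'a.
have [decp decq pq] := corner_inner_inverse ee ea ae aa'a.
set y := _ * (1 - a' * a).
have yE : y = (1 - a * a') * e * b * a * c * (e * (1 - a' * a)).
  by rewrite /y !mulrA (mulAE eb) (mulAE ce).
clearbody y; move: decp decq pq yE.
have [p pE] : exists p, p = a * a' * e by eexists.
rewrite -pE; move: (e * a' * a) ((1 - a * a') * e) (e * (1 - a' * a)).
move=> q P Q decp decq pq yE.
have [_ ep pe eP Pe] := orth_decP decp; have [pp PP pP Pp _] := decp.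
have [_ eq qe eQ Qe] := orth_decP decq; have [qq QQ qQ Qq _] := decq.
have Py : P * y = y by rewrite yE !mulrA PP.
have yQ : y * Q = y by rewrite yE (mulAE QQ).
have ey : e * y = y by rewrite -Py mulrA eP.
have ye : y * e = y by rewrite -yQ -mulrA Qe.
have [w ywy] := reg y.
(* A reflexive inner inverse of [y], going from the cokernel of [a] back to its
   kernel. *)
have [z zE] : exists z, z = Q * w * y * w * P by eexists.
have Qz : Q * z = z by rewrite zE !mulrA QQ.
have zP : z * P = z by rewrite zE (mulAE PP).
have ez : e * z = z by rewrite -Qz mulrA eQ.
have ze : z * e = z by rewrite -zP -mulrA Pe.
have yzy : y * z * y = y by rewrite zE !mulrA yQ (mulAE Py) !ywy.
have zyz : z * y * z = z.
  by rewrite zE !mulrA (mulAE Py) (mulAE yQ) !(mulA3E ywy).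
apply/(corner_unit_regular ee ey ye ez ze yzy zyz).
have decg : orth_dec P (y * z) (P - y * z).
  apply: orth_dec_sub; rewrite ?mulrA ?yzy // ?Py //; by rewrite -mulrA zP.
have dech : orth_dec Q (z * y) (Q - z * y).
  apply: orth_dec_sub; rewrite ?mulrA ?zyz // ?Qz //; by rewrite -mulrA yQ.
(* [g = y * z] is equivalent to the subidempotent [t * s] of [p], because [y]
   factors through [a]. *)
have [s sE] : exists s, s = y * z * P * b * p by eexists.
have [t tE] : exists t, t = a * c * z by eexists.
have st : s * t = y * z.
  rewrite sE tE pE !mulrA (mulAE ea) (mulA3E aa'a).
  have -> : y * z * P * b * a * c * z = y * z * (P * b * a * c * Q) * z.
    by rewrite !mulrA (mulAE Qz).
  by rewrite -yE yzy.
have ts_t : t * s * t = t by rewrite -mulrA st tE -!mulrA (mulrA z) zyz.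
have pt : p * t = t by rewrite pE tE !mulrA (mulAE ea) aa'a.
have sp : s * p = s by rewrite sE (mulAE pp).
have decj : orth_dec p (t * s) (p - t * s).
  apply: orth_dec_sub; rewrite ?mulrA ?ts_t // ?pt //; by rewrite -mulrA sp.
have [gg rg _ _ _] := decg; have [hh rh _ _ _] := dech.
have [jj rj _ _ _] := decj.
have deceg := orth_dec_shift decp decg; have deceh := orth_dec_shift decq dech.
have [egeg _ _ _ _] := orth_decP deceg; have [eheh _ _ _ _] := orth_decP deceh.
have gh : sidem gg ==~ sidem hh by apply/sidem_mvn; exists y, z.
have gj : sidem gg ==~ sidem jj by apply/sidem_mvn; exists s, t.
have pqE : sidem pp ==~ sidem qq by apply/sidem_mvn.
have ppE : sidem pp ==~ sidem gg +~ sidem rj by rewrite gj; apply: sidem_iadd.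
have egE : sidem egeg ==~ sidem gg +~ (sidem rj +~ sidem rg).
  by rewrite (sidem_iadd egeg pp rg) // ppE iaddA; reflexivity.
have ehE : sidem eheh ==~ sidem gg +~ (sidem rj +~ sidem rh).
  by rewrite (sidem_iadd eheh qq rh) // -pqE ppE iaddA; reflexivity.
apply/(sidem_mvn egeg eheh); rewrite egE ehE.
have shape g u v : (g +~ g) +~ (u +~ v) ==~ (g +~ u) +~ (g +~ v).
  exact: (vaddACA (@iaddC S) (@iaddA S)).
apply: (double_cancel (@iaddC S) (@iaddA S) sep); rewrite !shape -ppE.
transitivity (sidem ee).
  by rewrite -(sidem_iadd PP gg rg) //; symmetry; apply: sidem_iadd.
by rewrite pqE gh -(sidem_iadd QQ hh rh) //; apply: sidem_iadd.
Qed.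

(** The sum [2c + a] is realized by an idempotent [e] of [S], so that
    [e = p0 + P0 = q0 + Q0] with [p0], [q0] copies of [c], [P0] of [c + a] and
    [Q0] of [c + b]. Take for [a] in the corner condition an isomorphism [u]
    from [p0] to [q0]: its kernel and cokernel are then [c + a] and [c + b],
    whatever the inner inverse, and each contains a copy [c1], [c2] of [c]. An
    isomorphism [s] from [c1] to [c2] factors through [u], as the image of [u]
    is also a copy of [c]. Its kernel and cokernel on [S e] are [c + a] and
    [c + b], and unit-regularity of [s + (1 - e)] makes them isomorphic. *)
Lemma small_cancel_of_unit_regular (inn : S -> S) :
    (forall a, a * inn a * a = a) ->
    (forall e, e * e = e -> forall a b c,
      in_corner e a -> in_corner e b -> in_corner e c ->
      unit_regular ((1 - a * inn a) * b * a * c * (1 - inn a * a) + (1 - e))) ->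
  forall c a b : idem S, ibelow (c +~ c +~ a) (ione S) ->
    c +~ c +~ a ==~ c +~ c +~ b -> c +~ a ==~ c +~ b.
Proof.
move=> innE cond c a b [d oneE] E.
have [e [_ [ee [_ [_ eE _]]]]] := sidem_split oneE.
have eE1 : sidem ee ==~ c +~ (c +~ a) by rewrite eE iaddA; reflexivity.
have eE2 : sidem ee ==~ c +~ (c +~ b) by rewrite eE E iaddA; reflexivity.
have [p0 [P0 [p0p0 [P0P0 [decp0 p0c P0a]]]]] := sidem_split eE1.
have [q0 [Q0 [q0q0 [Q0Q0 [decq0 q0c Q0b]]]]] := sidem_split eE2.
have /sidem_mvn/(mvn_norm p0p0 q0q0) : sidem p0p0 ==~ sidem q0q0.
  by rewrite p0c q0c; reflexivity.
move=> [u [v [[uv vu p0u uq0] [q0v vp0]]]].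
have [_ ep0 p0e _ _] := orth_decP decp0.
have [_ eq0 q0e _ _] := orth_decP decq0.
have eu : e * u = u by rewrite -p0u mulrA ep0.
have ue : u * e = u by rewrite -uq0 -mulrA q0e.
have ev : e * v = v by rewrite -q0v mulrA eq0.
have ve : v * e = v by rewrite -vp0 -mulrA p0e.
have [decp decq pq] := corner_inner_inverse ee eu ue (innE u).
have uin : in_corner e u by apply/in_cornerP.
move: (cond e ee u) decp decq pq => /(_ _ _ uin) {cond}.
move: (inn u) (innE u) => u' uu'u.
have [p pE] : exists p, p = u * u' * e by eexists.
have [q qE] : exists q, q = e * u' * u by eexists.
have [P PE] : exists P, P = (1 - u * u') * e by eexists.
have [Q QE] : exists Q, Q = e * (1 - u' * u) by eexists.
rewrite -pE -qE -PE -QE => cond decp decq pq.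
have [_ ep pe eP Pe] := orth_decP decp; have [pp PP pP Pp epP] := decp.
have [_ eq qe eQ Qe] := orth_decP decq; have [qq QQ qQ Qq eqQ] := decq.
(* [p] and [p0] generate the same right ideal, [q] and [q0] the same left
   ideal. *)
have pp0 : p * p0 = p0 by rewrite -uv pE !mulrA (mulAE eu) uu'u.
have p0p : p0 * p = p by rewrite pE !mulrA p0u.
have q0q : q0 * q = q0 by rewrite -vu qE !mulrA (mulAE ue) (mulA3E uu'u).
have qq0 : q * q0 = q.
  by rewrite -{1}vu qE mulrA -[_ * u * v]mulrA uv -mulrA p0u.
have [_ _ _ _ ep0P0] := decp0; have [_ _ _ _ eq0Q0] := decq0.
have complE x x' : e = x + x' -> x' = e - x by move=> ->; rewrite addrC addKr.
have Pa : sidem PP ==~ c +~ a.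
  rewrite -P0a; apply/sidem_mvn; rewrite (complE _ _ epP) (complE _ _ ep0P0).
  exact: mvn_compl.
have Qb : sidem QQ ==~ c +~ b.
  rewrite -Q0b; apply/sidem_mvn; rewrite (complE _ _ eqQ) (complE _ _ eq0Q0).
  exact: mvn_compl_dual.
have pc : sidem pp ==~ c by rewrite -p0c; apply/sidem_mvn/mvn_of_mutual.
have qc : sidem qq ==~ c by rewrite -pc; symmetry; apply/sidem_mvn.
have [c1 [r1 [c1c1 [r1r1 [dec1 c1c r1a]]]]] := sidem_split Pa.
have [c2 [r2 [c2c2 [r2r2 [dec2 c2c r2b]]]]] := sidem_split Qb.
have /sidem_mvn/(mvn_norm c1c1 c2c2) : sidem c1c1 ==~ sidem c2c2.
  by rewrite c1c c2c; reflexivity.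
move=> [s [t [[st ts c1s sc2] [c2t tc1]]]].
have /sidem_mvn/(mvn_norm c1c1 p0p0) : sidem c1c1 ==~ sidem p0p0.
  by rewrite c1c p0c; reflexivity.
move=> [f [g [[fg gf c1f fp0] [p0g gc1]]]].
have [_ Pc1 c1P _ _] := orth_decP dec1; have [_ Qc2 c2Q _ _] := orth_decP dec2.
have ec1 : e * c1 = c1 by rewrite -Pc1 mulrA eP.
have c1e : c1 * e = c1 by rewrite -c1P -mulrA Pe.
have ec2 : e * c2 = c2 by rewrite -Qc2 mulrA eQ.
have c2e : c2 * e = c2 by rewrite -c2Q -mulrA Qe.
have es : e * s = s by rewrite -c1s mulrA ec1.
have se : s * e = s by rewrite -sc2 -mulrA c2e.
have et : e * t = t by rewrite -c2t mulrA ec2.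
have te : t * e = t by rewrite -tc1 -mulrA c1e.
have ef : e * f = f by rewrite -c1f mulrA ec1.
have fe : f * e = f by rewrite -fp0 -mulrA p0e.
(* [s = f u (v g s)], where [f] and [g] identify [c1] with [p0]. *)
have /cond : in_corner e f by apply/in_cornerP.
have : in_corner e (v * g * s).
  by apply/in_cornerP=> //; split; [rewrite !mulrA ev|rewrite -mulrA se].
move=> /[swap]/[apply].
have -> : (1 - u * u') * f * u * (v * g * s) * (1 - u' * u) = s.
  have -> : (1 - u * u') * f = f.
    by rewrite -{1}ef mulrA -PE -c1f mulrA Pc1.
  have -> : f * u * (v * g * s) = s.
    by rewrite !mulrA -[f * u * v]mulrA uv fp0 fg c1s.
  by rewrite -{1}se -mulrA -QE -sc2 -mulrA c2Q.
move/(corner_unit_regular ee es se et te); rewrite st ts c1s c2t.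
move=> /(_ erefl erefl) m.
have decl := orth_dec_shift decp dec1; have decr := orth_dec_shift decq dec2.
have [ll _ _ _ _] := orth_decP decl; have [rr _ _ _ _] := orth_decP decr.
transitivity (sidem ll).
  by rewrite (sidem_iadd ll pp r1r1) // pc r1a; reflexivity.
transitivity (sidem rr); first by apply/sidem_mvn.
by rewrite (sidem_iadd rr qq r2r2) // qc r2b; reflexivity.
Qed.

Lemma mx_separativeP (inn : S -> S) : regular_ring S ->
    (forall a, a * inn a * a = a) ->
  mx_separative S <->
  (forall e, e * e = e -> forall a b c,
      in_corner e a -> in_corner e b -> in_corner e c ->
      unit_regular ((1 - a * inn a) * b * a * c * (1 - inn a * a) + (1 - e))).
Proof.
move=> reg innE; split=> [sep e ee a b c ain bin cin|cond a b].
  exact: mx_separative_unit_regular.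
have refine (x y z w : idem S) := @iadd_refine S x y z w reg.
apply: (separative_of_small (@iaddC S) (@iaddA S) refine (r := ione S)).
- exact: small_cancel_of_unit_regular.
- by move=> P; apply: idem_generated.
Qed.

End CornerCondition.

(** * Finitely generated projective modules *)

Section Modules.
Context (S : pzRingType).
Implicit Types (A B M N : lmodType S).

(** [A] is the image of [e], up to isomorphism. *)
Definition represents n (e : 'M[S]_n) A :=
  exists (inj : {linear A -> 'rV[S]_n}) (proj : {linear 'rV[S]_n -> A}),
    (forall x, proj (inj x) = x) /\ (forall v, inj (proj v) = v *m e).

Definition lincomb M n (g : 'I_n -> M) (v : 'rV[S]_n) : M :=
  \sum_(i < n) v 0 i *: g i.

Lemma lincomb_is_linear M n (g : 'I_n -> M) : linear (lincomb g).
Proof.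
move=> k u v; rewrite /lincomb scaler_sumr -big_split /=.
by apply: eq_bigr => i _; rewrite !mxE scalerDl scalerA.
Qed.
HB.instance Definition _ M n (g : 'I_n -> M) :=
  GRing.isLinear.Build S 'rV[S]_n M _ (lincomb g) (lincomb_is_linear g).

Lemma linear_lincomb M n (f : {linear 'rV[S]_n -> M}) v :
  f v = lincomb (fun i => f (delta_mx 0 i)) v.
Proof.
rewrite {1}[v]row_sum_delta linear_sum /lincomb.
by apply: eq_bigr => i _; rewrite linearZ.
Qed.

(** A section of a surjection from a free module of finite rank composes with
    it to an idempotent endomorphism of the free module. *)
Lemma fp_represented A : fin_gen A -> projective A ->
  exists e : idem S, represents e A.
Proof.
move=> [n [g gen]] proj.
have surj y : exists x, lincomb g x = y.
  have [c ->] := gen y; exists (\row_i c i).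
  by apply: eq_bigr => i _; rewrite mxE.
have [s sE] :=
  proj _ _ (lincomb g : {linear _ -> _}) (idfun : {linear A -> A}) surj.
pose e := lin1_mx (s \o lincomb g).
have eE v : v *m e = s (lincomb g v) by rewrite mul_rV_lin1.
have ee : e *m e = e.
  by apply/row_matrixP=> i; rewrite row_mul !rowE !eE sE.
exists (Idem ee), s, (lincomb g); split=> [x|v]; [exact: sE|by rewrite /= eE].
Qed.

(** A retract of a free module of finite rank: lifts are chosen on the standard
    basis and restricted. *)
Lemma represented_fp n (e : 'M[S]_n) A :
  represents e A -> fin_gen A /\ projective A.
Proof.
move=> [inj [prj [prjK injK]]]; split.
  exists n, (fun i => prj (delta_mx 0 i)) => x; exists (fun i => inj x 0 i).
  by rewrite -{1}[x]prjK linear_lincomb.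
move=> M N p f surj.
have [m mE] : exists m : 'I_n -> M, forall i, p (m i) = f (prj (delta_mx 0 i)).
  by apply: (fin_all_exists (P := fun i y => p y = _)) => i; apply: surj.
exists (lincomb m \o inj) => x /=.
rewrite -{2}[x]prjK.
have -> : f (prj (inj x)) = _ := linear_lincomb (f \o prj) (inj x).
rewrite /lincomb linear_sum.
by apply: eq_bigr => i _; rewrite linearZ /= mE.
Qed.

Definition fixed_rows n (e : 'M[S]_n) : {pred 'rV[S]_n} :=
  fun v => v *m e == v.

Lemma fixed_rows_submod n (e : 'M[S]_n) : submod_closed (fixed_rows e).
Proof.
split=> [|k u v]; rewrite !unfold_in; first by rewrite mul0mx.
by move=> /eqP uE /eqP vE; rewrite mulmxDl -scalemxAl uE vE.
Qed.
HB.instance Definition _ n (e : 'M[S]_n) :=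
  GRing.isSubmodClosed.Build S 'rV[S]_n (fixed_rows e) (fixed_rows_submod e).

Record fixed_space n (e : 'M[S]_n) := FixedSpace
  { fixed_val :> 'rV[S]_n; fixed_valP : fixed_val \in fixed_rows e }.
HB.instance Definition _ n (e : 'M[S]_n) := [isSub for @fixed_val n e].
HB.instance Definition _ n (e : 'M[S]_n) := [Choice of fixed_space e by <:].
HB.instance Definition _ n (e : 'M[S]_n) :=
  [SubChoice_isSubLmodule of fixed_space e by <:].

Lemma fixed_space_represented (e : idem S) :
  represents e (fixed_space e : lmodType S).
Proof.
have row_fixed (v : 'rV[S]_(idim e)) : v *m e \in fixed_rows e.
  by rewrite unfold_in -mulmxA imxK.
pose prj v : fixed_space e := FixedSpace (row_fixed v).
have prj_lin : linear prj.
  by move=> k u v; apply: val_inj; rewrite linearP /= mulmxDl -scalemxAl.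
pose L := GRing.isLinear.Build S 'rV[S]_(idim e) (fixed_space e) _ prj prj_lin.
pose p : {linear 'rV[S]_(idim e) -> fixed_space e} := HB.pack prj L.
exists (val : {linear fixed_space e -> 'rV[S]_(idim e)}), p; split=> // x.
by apply: val_inj; apply/eqP; apply: (fixed_valP x).
Qed.

Lemma represents_prod (e f : idem S) A B :
  represents e A -> represents f B -> represents (iadd e f) (A * B)%type.
Proof.
move=> [i [p [pi ip]]] [j [q [qj jq]]].
pose inj (z : A * B) := row_mx (i z.1) (j z.2).
pose prj (v : 'rV[S]_(idim e + idim f)) := (p (lsubmx v), q (rsubmx v)).
have inj_lin : linear inj.
  by move=> k u v; rewrite /inj !linearP scale_row_mx add_row_mx.
have prj_lin : linear prj by move=> k u v; rewrite /prj !linearP.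
pose I : {linear (A * B)%type -> _} :=
  HB.pack inj (GRing.isLinear.Build S _ _ _ inj inj_lin).
pose P : {linear _ -> (A * B)%type} :=
  HB.pack prj (GRing.isLinear.Build S _ _ _ prj prj_lin).
exists I, P; split=> [[x y]|v] /=.
  by rewrite /prj /inj row_mxKl row_mxKr pi qj.
rewrite /inj /prj /= ip jq -{3}[v]hsubmxK mul_row_block !mulmx0.
by rewrite addr0 add0r.
Qed.

Lemma represents_iso (e f : idem S) A B : represents e A -> represents f B ->
  mod_iso A B <-> ieqv e f.
Proof.
move=> [i [p [pi ip]]] [j [q [qj jq]]]; split=> [[h [h' hK h'K]]|].
  have h'_lin := can2_linear hK h'K.
  pose h1 : {linear B -> A} :=
    HB.pack h' (GRing.isLinear.Build S _ _ _ h' h'_lin).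
  exists (lin1_mx (j \o h \o p)), (lin1_mx (i \o h1 \o q)).
  split; apply/row_matrixP=> k; rewrite row_mul !rowE !mul_rV_lin1 /=.
    by rewrite qj hK ip.
  by rewrite pi h'K jq.
case=> x [y [xy yx]].
exists (q \o mulmxr x \o i); exists (p \o mulmxr y \o j) => a /=.
  by rewrite jq -yx !mulmxA -(mulmxA (i a)) xy -(mulmxA _ x y) xy -!ip !pi.
by rewrite ip -xy !mulmxA -(mulmxA (j a)) yx -(mulmxA _ y x) yx -!jq !qj.
Qed.

End Modules.

(** Right [R]-modules are left modules over [R^c]. *)
Lemma separative_mx (R : pzRingType) : separative R <-> mx_separative R^c.
Proof.
split=> [sep a b aab abb|sep A B [Agen Aproj] [Bgen Bproj] iAAB iABB].
  have ra := fixed_space_represented a; have rb := fixed_space_represented b.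
  apply/(represents_iso ra rb); apply: sep.
  - exact: represented_fp ra.
  - exact: represented_fp rb.
  - by apply/(represents_iso (represents_prod ra ra) (represents_prod ra rb)).
  - by apply/(represents_iso (represents_prod ra rb) (represents_prod rb rb)).
have [a ra] := fp_represented Agen Aproj.
have [b rb] := fp_represented Bgen Bproj.
apply/(represents_iso ra rb); apply: sep.
  by apply/(represents_iso (represents_prod ra ra) (represents_prod ra rb)).
by apply/(represents_iso (represents_prod ra rb) (represents_prod rb rb)).
Qed.

(** * The converse ring *)

Lemma unit_regular_converse (R : pzRingType) (x : R) :
  @unit_regular R^c x <-> unit_regular x.
Proof.
by split=> -[u [[v [uv vu]] xux]]; exists u; split; [exists v|
  by apply: etrans xux; rewrite -[RHS]mulrA|exists v|
  by apply: etrans xux; rewrite -[LHS]mulrA].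
Qed.

Lemma in_corner_converse (R : pzRingType) (e a : R) :
  @in_corner R^c e a <-> in_corner e a.
Proof. by split=> -[r ->]; exists r; rewrite -[LHS]mulrA. Qed.

Theorem mainTheorem1 (R : pzRingType) (hR : regular_ring R)
    (inn : R -> R) (hinn : forall a : R, a * inn a * a = a) :
  separative R <->
  (forall e : R, idempotent_elt e ->
     forall a b c : R, in_corner e a -> in_corner e b -> in_corner e c ->
       unit_regular
         ((1 - a * inn a) * b * a * c * (1 - inn a * a) + (1 - e))).
Proof.
(* The condition is self-dual: passing to [R^c] reverses the products, which
   exchanges [b] and [c]. *)
have hinnc (a : R^c) : a * inn a * a = a.
  by apply: etrans (hinn a); apply: (@mulrA R).
have hRc : regular_ring R^c by move=> a; exists (inn a).
rewrite separative_mx (mx_separativeP hRc hinnc).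
have flip (e a b c : R) :
    ((1 : R^c) - (a : R^c) * inn a) * (b : R^c) * (a : R^c) * c
      * (1 - (inn a : R^c) * a) + (1 - (e : R^c))
    = (1 - a * inn a) * c * a * b * (1 - inn a * a) + (1 - e) :> R.
  have mulA4 (x y z w t : R) : x * y * z * w * t = x * (y * (z * (w * t))).
    by rewrite !mulrA.
  by rewrite [in RHS]mulA4.
split=> cond e ee a b c ain bin cin.
  apply: (iffLR (@unit_regular_converse R _)); rewrite -flip.
  by apply: cond => //; apply: (iffRL (@in_corner_converse R e _)).
rewrite flip; apply: (iffRL (@unit_regular_converse R _)).
by apply: cond => //; apply: (iffLR (@in_corner_converse R e _)).
Qed.
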